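(* Let $a>b>0$ be integers and let $f_0$ be defined by $f_0(1)=1$, $f_0(2)=a$, and $f_0(n+2)=af_0(n+1)-bf_0(n)$ for $n\ge 1$. For $1\le k\le n$ let $$c_1(n,k)=\sum_{i_1+i_2+\cdots+i_k=n}f_0(i_1)f_0(i_2)\cdots f_0(i_k),$$ the sum being over positive integers $i_1,\ldots,i_k$. Let $\alpha=\frac{a+\sqrt{a^2-4b}}{2b}$ and $\beta=\frac{a-\sqrt{a^2-4b}}{2b}$ be the solutions of the equation $bx^2-ax+1=0$. Then, for $1\le k\le n$, $$c_1(n,k)=\frac{1}{b^k}\sum_{j=0}^{n-k}\frac{1}{\alpha^{j+k}\beta^{n-j}}\binom{n-j-1}{k-1}\binom{k+j-1}{k-1}.$$ *)

(* Defs.v *)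
From mathcomp Require Import all_boot all_order all_algebra.

Set Implicit Arguments.
Unset Strict Implicit.
Unset Printing Implicit Defensive.

Import Order.TTheory GRing.Theory Num.Theory.
Local Open Scope ring_scope.

(* Parts are drawn from 'I_n.+1 only to make the index type finite: positive
   integers with sum n are all at most n, so no composition is lost. *)
Definition is_composition (n k : nat) (i : {ffun 'I_k -> 'I_n.+1}) : bool :=
  [forall l, (0 < i l)%N] && ((\sum_(l < k) i l)%N == n).

Definition c1 (f : nat -> int) (n k : nat) : int :=
  \sum_(i : {ffun 'I_k -> 'I_n.+1} | is_composition i) \prod_(l < k) f (i l).

(* Main.v *)
Require Import Defs.
From mathcomp Require Import all_boot all_order all_algebra.
From mathcomp Require Import ring zify.

(** The statement is an identity between coefficients of power series.  With
    [p = 1 / alpha] and [q = 1 / beta], Vieta gives [p + q = a] and [p q = b],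
    so the recurrence says that the generating function of [f0] is
      [x / (1 - a x + b x^2) = x / ((1 - p x) (1 - q x))].
    Summing over compositions into [k] parts amounts to taking the [k]-th
    power, whose coefficient at [x^n] is read off the binomial series
      [(1 - c x)^(-k) = \sum_i 'C(k - 1 + i, k - 1) c^i x^i]
    taken at [c = p] and [c = q]:
      [c1(n, k) = \sum_j 'C(k - 1 + j, k - 1) p^j
                         * 'C(n - j - 1, k - 1) q^(n - k - j)].
    The factor [1 / b^k = 1 / (p q)^k] of the stated formula only rescales
    [p^(j + k) q^(n - j)] to [p^j q^(n - k - j)].

    Power series are represented by their truncations below degree [N], that
    is, by polynomials up to the congruence [eq_trunc N].  The lemmas that carry
    the argument are [coef_parts_gf_exp] (compositions are counted by powers),
    [parts_gf_rec] (closed form of the generating function), [binom_gfP]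
    (binomial series) and [coef_parts_gf_roots], which combines the last two. *)

Set Implicit Arguments.
Unset Strict Implicit.
Unset Printing Implicit Defensive.

Import Order.TTheory GRing.Theory Num.Theory.
Local Open Scope ring_scope.

(** * Polynomials modulo a power of the variable *)

Definition eq_trunc (R : comNzRingType) (N : nat) (p q : {poly R}) : Prop :=
  forall i, (i < N)%N -> p`_i = q`_i.

Lemma eq_trunc_refl (R : comNzRingType) N (p : {poly R}) : eq_trunc N p p.
Proof. by []. Qed.

Lemma eq_trunc_sym (R : comNzRingType) N (p q : {poly R}) :
  eq_trunc N p q -> eq_trunc N q p.
Proof. by move=> pq i iN; rewrite pq. Qed.

Lemma eq_trunc_trans (R : comNzRingType) N (p q r : {poly R}) :
  eq_trunc N p q -> eq_trunc N q r -> eq_trunc N p r.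
Proof. by move=> pq qr i iN; rewrite pq ?qr. Qed.

Lemma eq_truncM (R : comNzRingType) N (p p' q q' : {poly R}) :
  eq_trunc N p p' -> eq_trunc N q q' -> eq_trunc N (p * q) (p' * q').
Proof.
move=> pp' qq' i iN; rewrite !coefM; apply: eq_bigr => -[j /= ji] _.
by rewrite pp' ?qq' //; lia.
Qed.

Lemma eq_truncX (R : comNzRingType) N (p q : {poly R}) k :
  eq_trunc N p q -> eq_trunc N (p ^+ k) (q ^+ k).
Proof.
move=> pq; elim: k => [|k IHk]; first exact: eq_trunc_refl.
by rewrite !exprS; apply: eq_truncM.
Qed.

(** * The binomial series *)

(** Truncation of the power series of [(1 - c x)^(-(k + 1))]. *)
Definition binom_gf (R : comNzRingType) (N k : nat) (c : R) : {poly R} :=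
  \poly_(i < N) ('C(k + i, k)%:R * c ^+ i).

(** Pascal's rule, read on coefficients: multiplying by [1 - c x] lowers the
    exponent by one. *)
Lemma binom_gfS (R : comNzRingType) N k (c : R) :
  eq_trunc N ((1 - c *: 'X) * binom_gf N k.+1 c) (binom_gf N k c).
Proof.
move=> i iN; rewrite mulrBl mul1r -scalerAl coefB coefZ coefXM !coef_poly iN.
case: i iN => [|i] iN /=; first by rewrite !addn0 !binn mulr0 subr0.
rewrite (ltnW iN) addSn -addSnnS binS addSnnS natrD exprS; ring.
Qed.

Lemma binom_gf0 (R : comNzRingType) N (c : R) :
  eq_trunc N ((1 - c *: 'X) * binom_gf N 0 c) 1.
Proof.
move=> i iN; rewrite mulrBl mul1r -scalerAl coefB coefZ coefXM !coef_poly iN.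
rewrite coef1; case: i iN => [|i] iN /=; first by rewrite bin0 mulr0 subr0 mulr1.
by rewrite (ltnW iN) !bin0 !mul1r exprS subrr.
Qed.

Lemma binom_gfP (R : comNzRingType) N k (c : R) :
  eq_trunc N ((1 - c *: 'X) ^+ k.+1 * binom_gf N k c) 1.
Proof.
elim: k => [|k IHk]; first by rewrite expr1; apply: binom_gf0.
apply: eq_trunc_trans IHk; rewrite exprSr -mulrA.
exact: eq_truncM (@eq_trunc_refl _ _ _) (@binom_gfS _ _ _ _).
Qed.

(** * Generating functions of parts and compositions *)

(** The constant coefficient is forced to [0], whatever [g 0] is, because the
    parts of a composition are positive. *)
Definition parts_gf (R : comNzRingType) (g : nat -> R) (N : nat) : {poly R} :=
  \poly_(i < N) (if (0 < i)%N then g i else 0).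

(** Distributing the [k]-th power over the monomials indexes its terms by
    [k]-tuples of exponents; those with a zero part vanish, and the others
    contribute in degree [n] exactly when they sum to [n]. *)
Lemma coef_parts_gf_exp (R : comNzRingType) (f : nat -> int) n k :
  (c1 f n k)%:~R = (parts_gf (fun i => (f i)%:~R : R) n.+1 ^+ k)`_n.
Proof.
rewrite /parts_gf poly_def -[k in RHS]card_ord -prodr_const bigA_distr_bigA /=.
rewrite coef_sum /c1 rmorph_sum /= big_mkcond /=; apply: eq_bigr => i _.
rewrite scaler_prod prodrXr coefZ coefXn /is_composition.
case: ifP => [/andP[/forallP i_gt0 /eqP ->]|].
  rewrite eqxx mulr1 rmorph_prod; apply: eq_bigr => l _.
  by rewrite i_gt0.
move=> /negbT; rewrite negb_and => /orP[/forallPn[l il]|].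
  by rewrite (bigD1 l) //= (negbTE il) !mul0r.
by rewrite eq_sym => /negbTE ->; rewrite mulr0.
Qed.

Lemma parts_gf_rec (R : comNzRingType) (g : nat -> R) (p q : R) N :
  g 1%N = 1 -> g 2%N = p + q ->
  (forall n, (1 <= n)%N ->
     g (n + 2)%N = (p + q) * g (n + 1)%N - (p * q) * g n) ->
  eq_trunc N (parts_gf g N * ((1 - p *: 'X) * (1 - q *: 'X))) 'X.
Proof.
move=> g1 g2 grec i iN.
have -> : parts_gf g N * ((1 - p *: 'X) * (1 - q *: 'X))
  = parts_gf g N - (p + q) *: ('X * parts_gf g N)
    + (p * q) *: ('X * ('X * parts_gf g N)).
  rewrite -!mul_polyC rmorphD rmorphM /=; ring.
rewrite coefD coefB !coefZ !coefXM coefX.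
have coefP m : (m < N)%N -> (parts_gf g N)`_m = if (0 < m)%N then g m else 0.
  by rewrite coef_poly => ->.
case: i iN => [|[|[|i]]] iN /=; rewrite !coefP /=; try lia.
- ring.
- rewrite g1; ring.
- rewrite g1 g2; ring.
- have := grec i.+1 isT; rewrite addn2 addn1 => ->; ring.
Qed.

(** The inverse of [((1 - p x) (1 - q x))^k] is a product of two binomial
    series, so the power of the generating function is [x^k] times a Cauchy
    product. *)
Lemma coef_parts_gf_roots (R : comNzRingType) (g : nat -> R) (p q : R) n k :
  g 1%N = 1 -> g 2%N = p + q ->
  (forall m, (1 <= m)%N ->
     g (m + 2)%N = (p + q) * g (m + 1)%N - (p * q) * g m) ->
  (k < n)%N ->
  (parts_gf g n.+1 ^+ k.+1)`_n =
    \sum_(j < (n - k.+1).+1)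
      ('C(k + j, k)%:R * p ^+ j) *
      ('C(k + (n - k.+1 - j), k)%:R * q ^+ (n - k.+1 - j)).
Proof.
move=> g1 g2 grec kn; set P := parts_gf g n.+1.
pose Bp := binom_gf n.+1 k p; pose Bq := binom_gf n.+1 k q.
pose u : {poly R} := 1 - p *: 'X; pose v : {poly R} := 1 - q *: 'X.
have PB : eq_trunc n.+1 (P ^+ k.+1) ('X ^+ k.+1 * (Bp * Bq)).
  have HP : eq_trunc n.+1 (P ^+ k.+1 * ((u ^+ k.+1 * Bp) * (v ^+ k.+1 * Bq)))
                          (P ^+ k.+1 * (1 * 1)).
    by do 2?[apply: eq_truncM => //]; apply: binom_gfP.
  rewrite !mulr1 in HP; apply: eq_trunc_trans (eq_trunc_sym HP) _.
  rewrite mulrACA (mulrA (P ^+ _)) -!exprMn.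
  apply: eq_truncM => //; apply: eq_truncX; exact: parts_gf_rec.
rewrite PB // coefXnM ltnNge kn /= coefM.
apply: eq_bigr => -[j /= jn] _; rewrite !coef_poly.
have -> : (j < n.+1)%N by lia.
by have -> : (n - k.+1 - j < n.+1)%N by lia.
Qed.

(** * The roots of [b x^2 - a x + 1] *)

(** From [b < a] over the integers, [a >= b + 1] and hence
    [a^2 - 4 b >= (b - 1)^2]. *)
Lemma discr_ge0 (a b : int) : 0 < b -> b < a -> 0 <= a ^+ 2 - 4 * b.
Proof. by move=> b0 ba; nia. Qed.

Lemma roots_vieta (R : rcfType) (a b : int) (alpha beta : R) :
  0 < b -> b < a ->
  alpha = (a%:~R + Num.sqrt (a ^+ 2 - 4 * b)%:~R) / (2 * b%:~R) ->
  beta = (a%:~R - Num.sqrt (a ^+ 2 - 4 * b)%:~R) / (2 * b%:~R) ->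
  b%:~R * (alpha + beta) = a%:~R /\ b%:~R * (alpha * beta) = 1.
Proof.
move=> b0 ba -> ->; have bR : b%:~R != 0 :> R by rewrite intr_eq0 gt_eqF.
have ss : Num.sqrt (a ^+ 2 - 4 * b)%:~R ^+ 2 = a%:~R ^+ 2 - 4 * b%:~R :> R.
  rewrite sqr_sqrtr ?ler0z ?discr_ge0 //.
  by rewrite rmorphB rmorphXn rmorphM.
move: (Num.sqrt _) ss => s ss; split; first by field.
have -> : b%:~R * ((a%:~R + s) / (2 * b%:~R) * ((a%:~R - s) / (2 * b%:~R)))
  = (a%:~R ^+ 2 - s ^+ 2) / (4 * b%:~R) by field.
by rewrite ss; field.
Qed.

Theorem proposition10 (R : rcfType) (a b : int) (hb : 0 < b) (hab : b < a)
    (f0 : nat -> int) (f0_1 : f0 1%N = 1) (f0_2 : f0 2%N = a)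
    (f0_rec : forall n : nat, (1 <= n)%N ->
       f0 (n + 2)%N = a * f0 (n + 1)%N - b * f0 n)
    (alpha beta : R)
    (halpha : alpha = (a%:~R + Num.sqrt (a ^+ 2 - 4 * b)%:~R) / (2 * b%:~R))
    (hbeta : beta = (a%:~R - Num.sqrt (a ^+ 2 - 4 * b)%:~R) / (2 * b%:~R)) :
  (forall x : R, b%:~R * x ^+ 2 - a%:~R * x + 1 = 0 <-> x = alpha \/ x = beta)
  /\
  (forall n k : nat, (1 <= k)%N -> (k <= n)%N ->
     (c1 f0 n k)%:~R =
       1 / b%:~R ^+ k *
       \sum_(0 <= j < (n - k).+1)
          1 / (alpha ^+ (j + k) * beta ^+ (n - j))
          * 'C(n - j - 1, k - 1)%:R * 'C(k + j - 1, k - 1)%:R :> R).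
Proof.
have [vD vM] := roots_vieta hb hab halpha hbeta.
have bR : b%:~R != 0 :> R by rewrite intr_eq0 gt_eqF.
split=> [x|n [//|k] _ kn].
  have -> : b%:~R * x ^+ 2 - a%:~R * x + 1
            = b%:~R * ((x - alpha) * (x - beta)).
    by rewrite -[X in _ + X]vM -vD; ring.
  split=> [/eqP|].
    rewrite !mulf_eq0 (negbTE bR) /= !subr_eq0 => /orP[]/eqP; tauto.
  by case=> ->; ring.
have : alpha * beta != 0.
  by apply/eqP => ab0; move: vM; rewrite ab0 mulr0 => /esym/eqP; rewrite oner_eq0.
rewrite mulf_eq0 negb_or => /andP[al0 be0].
have bE : b%:~R = alpha^-1 * beta^-1 :> R.
  apply: (mulIf (mulf_neq0 al0 be0)); rewrite vM; field.
  by rewrite al0 be0.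
have aE : a%:~R = alpha^-1 + beta^-1 :> R.
  by rewrite -vD bE; field; rewrite al0 be0.
rewrite coef_parts_gf_exp (coef_parts_gf_roots (p := alpha^-1) (q := beta^-1)) //.
- rewrite big_mkord mulr_sumr; apply: eq_bigr => -[j /= jn] _.
  rewrite bE; set m := (n - k.+1 - j)%N.
  have -> : (n - j = m + k.+1)%N by rewrite /m; lia.
  have -> : (m + k.+1 - 1 = k + m)%N by lia.
  have -> : (k.+1 + j - 1 = k + j)%N by lia.
  rewrite subn1 /= !exprD exprMn !exprVn.
  by field; rewrite !expf_neq0.
- by rewrite f0_1.
- by rewrite f0_2.
- by move=> m m0; rewrite f0_rec // rmorphB !rmorphM /= aE bE.
Qed.
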